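(* For every $m\in\mathbb{N}$ and every sufficiently large $n\in\mathbb{N}$ it holds that $$\mathsf{CC}(U_m\diamond\mathit{mKW}_{\textsc{Gen}_n})\ge m+\Omega(n^{1/6}).$$
   Context: ''Sufficiently large $n$'' means larger than a threshold that may depend on $m$; $A\ge B+\Omega(E)$ means $A\ge B+\kappa E$ for some absolute constant $\kappa>0$ (for all sufficiently large $n$). Given $\mathcal{T}\subseteq[n]^3$, $\mathcal{T}$ generates a point $w\in[n]$ if $w=1$, or if there is a triplet $(u,v,w)\in\mathcal{T}$ such that $\mathcal{T}$ generates $u$ and $v$ (inductive definition, i.e., the smallest such set of points). The function $g=\textsc{Gen}_n$ takes as input a set $\mathcal{T}\subseteq[n]^3$ (encoded by its characteristic vector in $\{0,1\}^{N}$, $N=n^3$) and outputs 1 iff $\mathcal{T}$ generates $n$. $U_m\diamond\mathit{mKW}_g$ is the following communication problem: Alice and Bob get matrices $X,Y\in\{0,1\}^{m\times N}$. Let $a,b\in\{0,1\}^m$ be obtained by applying $g$ to each row of $X$ and $Y$ respectively. It is promised that $a\ne b$ (a protocol only needs to be correct on such input pairs). The goal is to find $(i,j)$ such that ($a_i>b_i$ and $X_{i,j}>Y_{i,j}$), or ($a_i<b_i$ and $X_{i,j}<Y_{i,j}$), or ($a_i=b_i$ and $X_{i,j}\ne Y_{i,j}$). $\mathsf{CC}$ of a problem is the minimal depth of a deterministic protocol tree solving it. *)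

(* Defs.v *)
From mathcomp Require Import all_boot all_order all_algebra.
From mathcomp Require Import all_classical all_reals all_analysis.

Set Implicit Arguments.
Unset Strict Implicit.
Unset Printing Implicit Defensive.

Import Order.TTheory GRing.Theory Num.Theory.

Local Open Scope classical_set_scope.
Local Open Scope ring_scope.

Record comm_problem (A B O : Type) := CommProblem {
  promise : A -> B -> Prop;
  valid_output : A -> B -> O -> Prop
}.

Inductive protocol (A B O : Type) : Type :=
| Output of O
| AliceSpeaks of (A -> bool) & protocol A B O & protocol A B O
| BobSpeaks of (B -> bool) & protocol A B O & protocol A B O.

Arguments Output {A B O}.

Fixpoint run (A B O : Type) (P : protocol A B O) (x : A) (y : B) : O :=
  match P with
  | Output o => o
  | AliceSpeaks f P0 P1 => if f x then run P1 x y else run P0 x y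
  | BobSpeaks f P0 P1 => if f y then run P1 x y else run P0 x y
  end.

Fixpoint depth (A B O : Type) (P : protocol A B O) : nat :=
  match P with
  | Output _ => 0
  | AliceSpeaks _ P0 P1 | BobSpeaks _ P0 P1 => (maxn (depth P0) (depth P1)).+1
  end.

Definition solves (A B O : Type) (P : protocol A B O)
    (S : comm_problem A B O) : Prop :=
  forall x y, promise S x y -> valid_output S x y (run P x y).

(* The set of depths consists of natural numbers, so the infimum is a minimum
   whenever some protocol solves the problem; otherwise it is +oo.  Every protocol has
   an Output, so +oo occurs in particular when O is empty. *)
Definition CC (R : realType) (A B O : Type) (S : comm_problem A B O) : \bar R :=
  ereal_inf [set (depth P)%:R%:E | P in [set P | solves P S]].

Definition apply_rows (m N : nat) (g : 'rV[bool]_N -> bool)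
    (X : 'M[bool]_(m, N)) : 'cV[bool]_m :=
  \col_(i < m) g (row i X).

(* The strict comparisons between bits use the coercion of bool to nat. *)
Definition U_diamond_mKW (m N : nat) (g : 'rV[bool]_N -> bool) :
    comm_problem 'M[bool]_(m, N) 'M[bool]_(m, N) ('I_m * 'I_N)%type :=
  {| promise := fun X Y => apply_rows g X <> apply_rows g Y;
     valid_output := fun X Y ij =>
       let a := (apply_rows g X)^~ 0 in
       let b := (apply_rows g Y)^~ 0 in
       let: (i, j) := ij in
       [\/ (a i > b i)%N /\ (X i j > Y i j)%N,
           (a i < b i)%N /\ (X i j < Y i j)%N
         | a i = b i /\ X i j <> Y i j] |}.

Notation triplet n := ('I_n * 'I_n * 'I_n)%type.

Lemma card_triplet (n : nat) : #|{: triplet n}| = (n ^ 3)%N.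
Proof. by rewrite !card_prod card_ord !expnS expn0 muln1 mulnA. Qed.

(* The element of 'I_n with value k stands for the point k + 1 of
   [n] = {1, ..., n}. *)
Inductive generates (n : nat) (T : {set triplet n}) : 'I_n -> Prop :=
| generates_one (w : 'I_n) : w.+1 = 1%N -> generates T w
| generates_triplet (u v w : 'I_n) :
    (u, v, w) \in T -> generates T u -> generates T v -> generates T w.

(* The set whose characteristic vector is x, the triplets being listed in the
   order of their canonical enumeration. *)
Definition set_of_charvec (n : nat) (x : 'rV[bool]_(n ^ 3)) : {set triplet n} :=
  [set t : triplet n | x 0 (cast_ord (card_triplet n) (enum_rank t))]%SET.

Definition Gen (n : nat) (x : 'rV[bool]_(n ^ 3)) : bool :=
  `[< exists w : 'I_n, w.+1 = n /\ generates (set_of_charvec x) w >].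

(* Main.v *)
(* Since the threshold on n may depend on m, it suffices to bound the depth of
   protocols for the monotone Karchmer-Wigderson game of Gen_n by a larger power
   of n: filling all rows but one with zeroes embeds that game into
   U_m <> mKW.  The bound, of order n^(1/4), comes from the rank method applied to
   the pebbling of a pyramid of height h, lifted by an equality gadget.

   Each node v of the pyramid gets a value x v in option [r] from Alice and y v in
   [r] from Bob; v is "true" when x v = Some (y v).  Points of [n] encode pairs
   (v, value): Alice's triplets derive (v, x v) from (u, x u) and (w, x w) for the
   parents u, w of v, and Bob's are those that preserve the set of the pairs
   (v, Some (y v)).  A triplet of Alice that Bob misses shows a false source, a
   false node with true parents, or that the root is true.

   For a set S of nodes let d S say that some path from the root to a source
   avoids S.  The matrix A(x, y) = \sum_(S contains the true nodes) (-1)^|S| d S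
   vanishes when the root is true or some false node has true parents.  When the
   source v is false only the S with d S <> d (v |: S) contribute; these have at
   least h elements, so A coincides there with a matrix of rank at most K, the
   number of partial maps from the nodes to [r] undefined on at least h nodes.
   Hence rank A <= 2^depth * K, whereas rank A >= r^|V| because d set0 holds.  For
   r = 4 |V| the two bounds give 2^h <= 2^(depth + 1). *)
Require Import Defs.
From mathcomp Require Import all_boot all_order all_algebra.
From mathcomp Require Import all_classical all_reals all_analysis.
From mathcomp Require Import fintype finset zify.

Import Order.TTheory GRing.Theory Num.Theory.

Set Implicit Arguments.
Unset Strict Implicit.

(** * Free paths in the pyramid *)

Local Open Scope nat_scope.

(* Node (i, j) of the pyramid has parents (i.+1, j) and (i, j.+1); s marks the
   pebbled nodes, and l is the distance from (a, b) to the sources. *)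
Fixpoint free_path (s : nat -> nat -> bool) (l a b : nat) : bool :=
  ~~ s a b &&
  (if l is l'.+1 then free_path s l' a.+1 b || free_path s l' a b.+1 else true).

Lemma free_path_swap s l a b :
  free_path s l a b = free_path (fun i j => s j i) l b a.
Proof. by elim: l a b => //= l IH a b; rewrite !IH orbC. Qed.

Lemma free_path_anti (s s' : nat -> nat -> bool) (l a b : nat) :
  (forall i j, s i j -> s' i j) -> free_path s' l a b -> free_path s l a b.
Proof.
move=> ss'; elim: l a b => [|l IH] a b /= /andP[nsab].
  by rewrite (contra (ss' a b) nsab).
by rewrite (contra (ss' a b) nsab) /= => /orP[]/IH ->; rewrite ?orbT.
Qed.

Lemma free_path_column s l a b :
  (forall i, i <= l -> ~~ s a (b + i)) -> free_path s l a b.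
Proof.
elim: l b => [|l IH] b sP /=; first by rewrite -[b]addn0 sP.
rewrite -[b in s a b]addn0 sP //= IH ?orbT // => i le_il.
by rewrite addSnnS sP.
Qed.

(* The pebbles (elements of t) are found one for each edge of the free path: the
   straight line leaving the path at that edge in the other direction avoids
   (a0, b0), so it is blocked in s itself. *)
Lemma free_path_add_source (s s' : nat -> nat -> bool) (a0 b0 l a b : nat) :
  (forall i j, s' i j -> s i j || ((i == a0) && (j == b0))) ->
  a + b + l <= a0 + b0 -> free_path s l a b -> ~~ free_path s' l a b ->
  [/\ a <= a0, b <= b0 & exists2 t : seq (nat * nat), uniq t /\ size t = l &
    forall p, p \in t -> [/\ s p.1 p.2, a <= p.1, b <= p.2 & p.1 + p.2 <= a + b + l]].
Proof.
elim: l s s' a0 b0 a b => [|l IH] s s' a0 b0 a b ss' le_ab.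
  rewrite /= !andbT negbK => sab /ss'; rewrite (negbTE sab) /= => /andP[/eqP<- /eqP<-].
  by split=> //; exists [::].
move=> fr nfr.
wlog : s s' a0 b0 a b ss' le_ab fr nfr / free_path s l a.+1 b => [wl|fr1].
  move: (fr) => /= /andP[_ /orP[fr1|fr1]]; first exact: wl ss' _ _ _ _.
  have [|||||le1 le2 [t [ut st] tP]] := wl (fun i j => s j i) (fun i j => s' j i) b0 a0 b a.
  - by move=> i j /ss'; rewrite andbC.
  - by lia.
  - by rewrite -free_path_swap.
  - by rewrite -free_path_swap.
  - by rewrite -free_path_swap.
  split=> //; exists [seq (p.2, p.1) | p <- t].
    by rewrite size_map map_inj_uniq // => -[? ?] [? ?] [-> ->].
  by move=> _ /mapP[[i j] /tP[/= ? ? ? ?] ->]; split=> //=; lia.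
have nsab : ~~ s' a b.
  move: fr => /= /andP[sab _]; apply/negP => /ss'; rewrite (negbTE sab) /=.
  by move=> /andP[/eqP ? /eqP ?]; lia.
move: nfr; rewrite /= nsab /= negb_or => /andP[nfr1 nfr2].
have [|le1 le2 [t [ut st] tP]] := IH s s' a0 b0 a.+1 b ss' _ fr1 nfr1; first by lia.
have [i /andP[le_il /ss' s'i]] : exists i, (i <= l) && s' a (b.+1 + i).
  case: (boolP [exists i : 'I_l.+1, s' a (b.+1 + i)]).
    by case/existsP => i ?; exists i; rewrite -ltnS ltn_ord.
  rewrite negb_exists => /forallP nE; case/negP: nfr2; apply: free_path_column => i le_il.
  by have := nE (inord i); rewrite inordK.
have {s'i} si : s a (b.+1 + i) by case/orP: s'i => // /andP[/eqP ? _]; lia.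
split; [lia | lia | exists ((a, b.+1 + i) :: t)].
  rewrite /= ut st andbT; split=> //.
  by apply/negP => /tP[_ /=]; rewrite ltnn.
move=> [i' j']; rewrite inE => /orP[/eqP[-> ->]|/tP[/= ? ? ? ?]]; split=> //=; lia.
Qed.

(** A free path through (a0, b0) would have to continue to one of its two parents, both blocked; the
    strict inequality puts (a0, b0) before the last diagonal, so a path cannot end there. *)
Lemma free_path_add_internal (s s' : nat -> nat -> bool) (a0 b0 l a b : nat) :
  (forall i j, s' i j = s i j || ((i == a0) && (j == b0))) ->
  s a0.+1 b0 -> s a0 b0.+1 -> a0 + b0 < a + b + l ->
  free_path s' l a b = free_path s l a b.
Proof.
move=> ss' s1 s2; elim: l a b => [|l IH] a b lt_ab /=.
  rewrite ss'; case: (@andP (a == a0)) => [[/eqP ? /eqP ?]|]; first by lia.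
  by rewrite orbF.
rewrite !IH; [|lia|lia]; rewrite ss'.
case: (@andP (a == a0)) => [[/eqP -> /eqP ->]|]; last by rewrite orbF.
by case: l {IH lt_ab} => [|l] /=; rewrite s1 s2 /= !andbF.
Qed.

(** * Rank of matrices of rationals and protocols *)

Local Open Scope ring_scope.

Definition rank_le (X Y : Type) (N : nat) (A : X -> Y -> rat) : Prop :=
  exists K : finType, (#|K| <= N)%N /\
  exists (b : K -> X -> rat) (c : K -> Y -> rat),
    forall x y, A x y = \sum_k b k x * c k y.

Lemma rank_leW (X Y : Type) (N M : nat) (A : X -> Y -> rat) :
  (N <= M)%N -> rank_le N A -> rank_le M A.
Proof. by move=> leNM [K [leK bc]]; exists K; split=> //; apply: leq_trans leNM. Qed.

Lemma rank_le0 (X Y : Type) (N : nat) : rank_le N (fun (_ : X) (_ : Y) => 0).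
Proof.
exists void; rewrite card_void; split=> //.
by exists (fun _ _ => 0), (fun _ _ => 0) => x y; rewrite big1 // => k; rewrite mul0r.
Qed.

Lemma rank_leD (X Y : Type) (N M : nat) (A B : X -> Y -> rat) :
  rank_le N A -> rank_le M B -> rank_le (N + M) (fun x y => A x y + B x y).
Proof.
move=> [K [leK [b [c Abc]]]] [L [leL [b' [c' Bbc]]]].
exists (K + L)%type; rewrite card_sum leq_add //; split=> //.
exists (fun k => match k with inl i => b i | inr i => b' i end).
exists (fun k => match k with inl i => c i | inr i => c' i end) => x y.
by rewrite big_sumType Abc Bbc.
Qed.

Lemma rank_leM (X Y : Type) (N : nat) (A : X -> Y -> rat) (f : X -> rat)
    (g : Y -> rat) :
  rank_le N A -> rank_le N (fun x y => f x * g y * A x y).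
Proof.
move=> [K [leK [b [c Abc]]]]; exists K; split=> //.
exists (fun k x => f x * b k x), (fun k y => g y * c k y) => x y.
by rewrite Abc mulr_sumr; apply: eq_bigr => k _; rewrite mulrACA.
Qed.

Lemma eq_rank_le (X Y : Type) (N : nat) (A B : X -> Y -> rat) :
  (forall x y, A x y = B x y) -> rank_le N A -> rank_le N B.
Proof.
move=> eqAB [K [leK [b [c Abc]]]]; exists K; split=> //; exists b, c => x y.
by rewrite -eqAB Abc.
Qed.

(** Each bit splits the matrix into two, each masked by an indicator that depends on the speaker's
    input only; masking keeps the rank bound, so every level at most doubles it. *)
Lemma rank_le_run (A B O X Y : Type) (P : protocol A B O) (fA : X -> A)
    (fB : Y -> B) (N : nat) (M : O -> X -> Y -> rat) :
  (forall o, rank_le N (M o)) ->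
  rank_le (2 ^ depth P * N) (fun x y => M (run P (fA x) (fB y)) x y).
Proof.
move=> rkM; elim: P => [ans | f P0 IH0 P1 IH1 | f P0 IH0 P1 IH1] /=.
- by rewrite mul1n.
- apply: (@rank_leW _ _ (2 ^ depth P1 * N + 2 ^ depth P0 * N)).
    by rewrite -mulnDl leq_mul2r expnS mul2n -addnn leq_add ?orbT // leq_exp2l
               ?leq_maxl ?leq_maxr.
  apply: eq_rank_le (rank_leD (rank_leM (fun x => (f (fA x))%:R) (fun=> 1) IH1)
                    (rank_leM (fun x => (~~ f (fA x))%:R) (fun=> 1) IH0)) => x y.
  by case: (f _); rewrite ?mul1r ?mul0r ?addr0 ?add0r.
- apply: (@rank_leW _ _ (2 ^ depth P1 * N + 2 ^ depth P0 * N)).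
    by rewrite -mulnDl leq_mul2r expnS mul2n -addnn leq_add ?orbT // leq_exp2l
               ?leq_maxl ?leq_maxr.
  apply: eq_rank_le (rank_leD (rank_leM (fun=> 1) (fun y => (f (fB y))%:R) IH1)
                    (rank_leM (fun=> 1) (fun y => (~~ f (fB y))%:R) IH0)) => x y.
  by case: (f _); rewrite ?mul1r ?mul0r ?addr0 ?add0r.
Qed.

Lemma card_le_rank_diag (Y K : finType) (e : rat) (b : Y -> K -> rat)
    (c : K -> Y -> rat) :
  e != 0 -> (forall y y', \sum_k b y k * c k y' = e * (y == y')%:R) ->
  (#|Y| <= #|K|)%N.
Proof.
move=> e0 bcE.
pose B := \matrix_(i < #|Y|, j < #|K|) b (enum_val i) (enum_val j).
pose C := \matrix_(i < #|K|, j < #|Y|) c (enum_val i) (enum_val j).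
have BC : B *m C = e%:M.
  apply/matrixP => i j; rewrite !mxE -mulr_natr -(inj_eq enum_val_inj) -bcE.
  rewrite (reindex_onto (@enum_val K predT) enum_rank) => [|k _]; last exact: enum_rankK.
  rewrite [RHS](eq_bigl xpredT) => [|k]; last by rewrite enum_valK eqxx.
  by apply: eq_bigr => k _; rewrite !mxE.
have := mxrankM_maxr B C; rewrite BC -scalemx1 mxrank_scale_nz // mxrank1.
by move=> /leq_trans; apply; apply: rank_leq_row.
Qed.

(** * Alternating sums over subsets *)

Section AlternatingSums.
Variable V : finType.
Implicit Types (S T : {set V}) (G : {set V} -> rat).

Lemma alt_sum_pair (v : V) G :
  \sum_(S : {set V}) (-1) ^+ #|S| * G S =
  \sum_(S : {set V} | v \notin S) (-1) ^+ #|S| * (G S - G (v |: S)).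
Proof.
rewrite (bigID (fun S : {set V} => v \notin S)) /=.
rewrite [X in _ + X](reindex_onto (fun S : {set V} => v |: S) (fun S => S :\ v)) /=; last first.
  by move=> S; rewrite negbK => vS; rewrite setD1K.
rewrite [X in _ + X](eq_bigl (fun S : {set V} => v \notin S)); last first.
  move=> S; rewrite setU11 /=; apply/eqP/idP => [<-|vS]; first by rewrite setD11.
  by rewrite setU1K.
rewrite -big_split /=; apply: eq_bigr => S vS.
by rewrite cardsU1 vS exprS mulN1r mulNr mulrBr.
Qed.

Lemma alt_sum_eq0 (v : V) G :
  (forall S, v \notin S -> G (v |: S) = G S) -> \sum_(S : {set V}) (-1) ^+ #|S| * G S = 0.
Proof.
by move=> GE; rewrite (alt_sum_pair v) big1 // => S /GE ->; rewrite subrr mulr0.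
Qed.

End AlternatingSums.

(** * The lifted matrix *)

Section EqualityGadget.
Variables V W : finType.
Implicit Types (x : {ffun V -> option W}) (y : {ffun V -> W}) (S T : {set V}).

Definition agree x y : {set V} := [set v | x v == Some (y v)].

Definition undef (f : {ffun V -> option W}) : {set V} := [set v | f v == None].

(* For fixed S the indicator of [agree x y \subset S] is the sum, over the maps f
   undefined exactly on S, of [f avoids x] * [f agrees with y]. *)
Lemma rank_le_agree (k : nat) (a : {set V} -> rat) :
  (forall S, (#|S| < k)%N -> a S = 0) ->
  rank_le #|[set f | (k <= #|undef f|)%N]|
    (fun x y => \sum_(S : {set V}) a S * (agree x y \subset S)%:R).
Proof.
move=> a0; pose D := [set f : {ffun V -> option W} | (k <= #|undef f|)%N].
exists {f in D}; split; first by rewrite card_sig.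
exists (fun (f : {f in D}) x => [forall v, (val f v != None) ==> (val f v != x v)]%:R).
exists (fun (f : {f in D}) y => a (undef (val f)) *
  [forall v, (val f v == None) || (val f v == Some (y v))]%:R) => x y.
pose F (f : {ffun V -> option W}) : rat :=
  [forall v, (f v != None) ==> (f v != x v)]%:R * (a (undef f) *
  [forall v, (f v == None) || (f v == Some (y v))]%:R).
transitivity (\sum_(f in D) F f); last exact: big_sub.
transitivity (\sum_f F f); last first.
  rewrite [RHS]big_mkcond; apply: eq_bigr => f _.
  by rewrite inE; case: leqP => // /a0 E; rewrite /F E mul0r mulr0.
pose g S : {ffun V -> option W} := [ffun v => if v \in S then None else Some (y v)].
have undef_g S : undef (g S) = S.
  by apply/setP => v; rewrite inE ffunE; case: (v \in S).
rewrite [RHS](bigID (fun f => g (undef f) == f)) /= [X in _ + X]big1 ?addr0; last first.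
  move=> f /eqP ne; rewrite /F [X in _ * (_ * X)](_ : _ = 0) ?mulr0 //.
  case: forallP => // E; case: ne; apply/ffunP => v; rewrite ffunE inE.
  by have /orP[/eqP->|/eqP->] := E v.
rewrite [RHS](reindex_onto g undef) => [|f /eqP //].
rewrite [RHS](eq_bigl xpredT) => [|S]; last by rewrite undef_g !eqxx.
apply: eq_bigr => S _; rewrite /F undef_g mulrCA -natrM mulnb.
congr (_ * (_ : bool)%:R); apply/subsetP/andP => [sub | [/forallP sub _] v].
  split; apply/forallP => v; rewrite ffunE; have := sub v; rewrite inE.
    by case: (v \in S) => // /implyP; rewrite implybF eq_sym.
  by case: (v \in S); rewrite ?eqxx ?orbT.
rewrite inE; have := sub v; rewrite ffunE.
by case: (v \in S) => //=; rewrite eq_sym => /negbTE ->.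
Qed.

(** Give [None] weight 2 and every other value weight 1: expanding the product over V of the total
    weight [#|W| + 2] yields the sum of [2 ^ #|undef f|], in which each counted f contributes at
    least [2 ^ k]. *)
Lemma card_undef (k : nat) :
  (#|[set f | (k <= #|undef f|)%N]| * 2 ^ k <= (#|W| + 2) ^ #|V|)%N.
Proof.
have -> : ((#|W| + 2) ^ #|V| = \sum_f 2 ^ #|undef f|)%N.
  rewrite -prod_nat_const.
  transitivity (\prod_(v : V) \sum_(w : option W) (if w == None then 2 else 1))%N.
    apply: eq_bigr => _ _; rewrite (bigD1 None) //= addnC; congr (_ + _)%N.
    rewrite (eq_bigr (fun=> 1%N)) => [|w /negbTE -> //].
    by rewrite sum1_card (cardC1 (None : option W)) card_option.
  rewrite bigA_distr_bigA; apply: eq_bigr => f _.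
  rewrite -big_mkcond /= prod_nat_const; congr (2 ^ _)%N.
  by apply: eq_card => v; rewrite inE.
rewrite -sum_nat_const big_mkcond leq_sum // => f _; rewrite inE.
by case: ifP => // le; rewrite leq_pexp2l.
Qed.

Variable d : {set V} -> bool.

(* With z v := [x v = Some (y v)] this is the multilinear polynomial in z whose
   coefficient of \prod_(v in ~: S) (1 - z v) is (-1)^|S| d S. *)
Definition gadget_mx x y : rat :=
  \sum_(S : {set V}) (-1) ^+ #|S| * (d S && (agree x y \subset S))%:R.

Lemma gadget_mx_sink (t : V) x y :
  (forall S, t \in S -> ~~ d S) -> t \in agree x y -> gadget_mx x y = 0.
Proof.
move=> dt tZ; rewrite /gadget_mx big1 // => S _.
case: (boolP (d S)) => [dS|_]; last by rewrite mulr0.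
case: (boolP (_ \subset _)) => [/subsetP/(_ _ tZ) tS|_]; last by rewrite mulr0.
by have := dt _ tS; rewrite dS.
Qed.

Lemma subset_setU1_notin (v : V) (Z S : {set V}) :
  v \notin Z -> (Z \subset v |: S) = (Z \subset S).
Proof.
move=> vZ; apply/subsetP/subsetP => sub u uZ; have := sub u uZ; rewrite !inE.
  by case: eqVneq uZ vZ => // -> ->.
by move=> ->; rewrite orbT.
Qed.

(** Only sets S containing u and w contribute, and for these the terms of S and [v |: S] cancel. *)
Lemma gadget_mx_internal (u w v : V) x y :
  (forall S, u \in S -> w \in S -> d (v |: S) = d S) ->
  u \in agree x y -> w \in agree x y -> v \notin agree x y -> gadget_mx x y = 0.
Proof.
move=> dv uZ wZ vZ; apply: (alt_sum_eq0 (v := v)) => S vS.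
rewrite subset_setU1_notin //; case: (boolP (_ \subset S)); last by rewrite !andbF.
by move=> /subsetP sub; rewrite dv ?sub.
Qed.

(** What is left of [gadget_mx] after pairing S with [v |: S] when v is false; it is defined for all
    x and y so that its rank can be bounded. *)
Definition source_mx (v : V) x y : rat :=
  \sum_(S : {set V}) ((v \notin S)%:R * (-1) ^+ #|S| * ((d S)%:R - (d (v |: S))%:R)) *
     (agree x y \subset S)%:R.

Lemma gadget_mx_source (v : V) x y :
  v \notin agree x y -> gadget_mx x y = source_mx v x y.
Proof.
move=> vZ; rewrite /gadget_mx /source_mx (alt_sum_pair v) big_mkcond /=.
apply: eq_bigr => S _; case: ifP => vS; last by rewrite !mul0r.
rewrite subset_setU1_notin // mul1r -mulrA; congr (_ * _).
by case: (_ \subset _); rewrite ?andbT ?andbF ?mulr1 ?mulr0 ?subrr.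
Qed.

Lemma rank_le_source_mx (v : V) (k : nat) :
  (forall S, v \notin S -> d S != d (v |: S) -> (k <= #|S|)%N) ->
  rank_le #|[set f | (k <= #|undef f|)%N]| (source_mx v).
Proof.
move=> dk; apply: rank_le_agree => S; rewrite ltnNge => kS.
case: (boolP (v \in S)) => vS; first by rewrite !mul0r.
suff -> : d S = d (v |: S) by rewrite subrr mulr0.
by apply/eqP; apply: contraNT kS; apply: dk.
Qed.

(* The alternating sum, over T, of the rows indexed by y with the coordinates in
   T erased is a multiple of the row of the identity matrix indexed by y: only
   the term S = set0 of gadget_mx survives. *)
Lemma gadget_mx_rank (N : nat) :
  d finset.set0 -> rank_le N gadget_mx -> (#|W| ^ #|V| <= N)%N.
Proof.
move=> d0 [K [leK [b [c bcE]]]]; apply: leq_trans leK; rewrite -card_ffun.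
pose h (T : {set V}) y : {ffun V -> option W} :=
  [ffun v => if v \in T then None else Some (y v)].
apply: (@card_le_rank_diag _ _ ((-1) ^+ #|V|)
  (fun y k => \sum_(T : {set V}) (-1) ^+ #|T| * b k (h T y)) c).
  by rewrite signr_eq0.
move=> y y'.
transitivity (\sum_(T : {set V}) (-1) ^+ #|T| * gadget_mx (h T y) y').
  under eq_bigr do rewrite mulr_suml.
  rewrite exchange_big /=; apply: eq_bigr => T _; rewrite bcE mulr_sumr.
  by apply: eq_bigr => k _; rewrite mulrA.
have agreeE T S : (agree (h T y) y' \subset S) = ([set v | y v == y' v] \subset T :|: S).
  apply/subsetP/subsetP => sub v; have := sub v; rewrite !inE ffunE.
    by case: (v \in T).
  by case: (v \in T) => //= E.
transitivity (\sum_(S : {set V}) (-1) ^+ #|S| * (d S)%:R *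
   \sum_(T : {set V}) (-1) ^+ #|T| * ([set v | y v == y' v] \subset T :|: S)%:R : rat).
  under eq_bigr do rewrite mulr_sumr.
  rewrite exchange_big /=; apply: eq_bigr => S _; rewrite mulr_sumr.
  by apply: eq_bigr => T _; rewrite agreeE -mulnb natrM [RHS]mulrCA !mulrA.
rewrite (bigD1 finset.set0) //= [X in _ + X]big1 ?addr0; last first.
  move=> S /set0Pn[v vS]; rewrite (alt_sum_eq0 (v := v)) ?mulr0 // => T _.
  have vUS : v |: S = S by apply/setUidPr; rewrite sub1set.
  by rewrite [v |: T]setUC -setUA vUS.
rewrite cards0 expr0 d0 !mul1r.
have [<-|ne] := eqVneq y y'.
  rewrite (bigD1 finset.setT) //= [X in _ + X]big1 ?addr0.
    by rewrite cardsT setTU finset.subsetT.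
  move=> T neT; rewrite [X in _ * X](_ : _ = 0) ?mulr0 //.
  rewrite setU0; case: subsetP => // sub; case/eqP: neT; apply/setP => v.
  by rewrite inE sub // inE.
have [v nev] : exists v, y v != y' v.
  apply/existsP; apply: contraNT ne; rewrite negb_exists => /forallP E.
  by apply/eqP/ffunP => v; have := E v; rewrite negbK => /eqP.
rewrite mulr0; apply: (alt_sum_eq0 (v := v)) => T _.
by rewrite -setUA subset_setU1_notin // inE.
Qed.

End EqualityGadget.

(** * Reduction to the generation problem *)

Section Grid.
Variable h : nat.
Notation V := ('I_h.+1 * 'I_h.+1)%type.
Implicit Types (S : {set V}) (v : V).

Definition pebbled S (i j : nat) : bool :=
  [exists v in S, (v.1 == i :> nat) && (v.2 == j :> nat)].

Lemma pebbled_mem S v : pebbled S v.1 v.2 = (v \in S).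
Proof.
apply/existsP/idP => [[[i j] /and3P[uS /eqP ei /eqP ej]]|vS]; last first.
  by exists v; rewrite vS !eqxx.
by case: v ei ej => i' j' /= /val_inj <- /val_inj <-.
Qed.

Lemma pebbled_setU1 S v i j :
  pebbled (v |: S) i j = pebbled S i j || ((i == v.1) && (j == v.2)).
Proof.
apply/existsP/orP => [[u /and3P[]]|].
  rewrite !inE => /orP[/eqP-> /eqP <- /eqP <-|uS ui uj]; first by right; rewrite !eqxx.
  by left; apply/existsP; exists u; rewrite uS ui.
case=> [/existsP[u /and3P[uS ui uj]]|/andP[/eqP-> /eqP->]].
  by exists u; rewrite !inE uS orbT ui.
by exists v; rewrite setU11 !eqxx.
Qed.

Definition grid_free S : bool := free_path (pebbled S) h 0 0.

(* The nodes strictly beyond the diagonal also count as sources. *)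
Definition is_source v : bool := (h <= v.1 + v.2)%N.
(** At the border [inord] falls back to 0; off [is_source] both coordinates are below h, so there it
    is exact. *)
Definition parent1 v : V := (inord v.1.+1, v.2).
Definition parent2 v : V := (v.1, inord v.2.+1).

Lemma grid_free0 : grid_free finset.set0.
Proof.
apply: free_path_column => i _; apply/existsPn => v; by rewrite inE.
Qed.

Lemma grid_free_root S : (ord0, ord0) \in S -> ~~ grid_free S.
Proof.
rewrite -pebbled_mem /= => pS; rewrite /grid_free.
by case: (X in free_path _ X) => [|l] /=; rewrite pS.
Qed.

Lemma grid_free_internal S v :
  ~~ is_source v -> parent1 v \in S -> parent2 v \in S ->
  grid_free (v |: S) = grid_free S.
Proof.
rewrite /is_source -ltnNge => vh; rewrite -!pebbled_mem /= !inordK; [|lia|lia] => p1 p2.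
by apply: (@free_path_add_internal _ _ v.1 v.2) => //; apply: pebbled_setU1.
Qed.

Lemma grid_free_source S v :
  is_source v -> v \notin S -> grid_free S != grid_free (v |: S) -> (h <= #|S|)%N.
Proof.
move=> vh vS; have [dvS|ndvS] := boolP (grid_free (v |: S)).
  suff -> : grid_free S by [].
  by apply: free_path_anti dvS => i j; rewrite pebbled_setU1 => ->.
case: (boolP (grid_free S)) => // dS _.
have [||_ _ [t [ut st] tP]] := free_path_add_source _ _ dS ndvS (a0 := v.1) (b0 := v.2).
- by move=> i j; rewrite pebbled_setU1.
- by [].
apply: (@leq_trans (size t)); first by rewrite st.
rewrite cardE -(size_map (fun u : V => (u.1 : nat, u.2 : nat))).
apply: uniq_leq_size => // -[i j] /tP[/= /existsP[u /and3P[uS /eqP <- /eqP <-]] _ _ _] /=.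
by apply/mapP; exists u => //; rewrite mem_enum.
Qed.

Section Reduction.
Variables (W : finType) (N : nat).
Hypothesis leN : (#|{: V * option W}| <= N)%N.
Implicit Types (x : {ffun V -> option W}) (y : {ffun V -> W}) (t : triplet N.+2).

(* The points ord0 and ord_max of [n] are kept for the initial and final ones. *)
Definition code (p : V * option W) : 'I_N.+2 := inord (enum_rank p).+1.

Lemma codeE p : code p = (enum_rank p).+1 :> nat.
Proof. by rewrite inordK // ltnS; apply: leqW; apply: leq_trans leN; apply: ltn_ord. Qed.

Lemma code_inj : injective code.
Proof. by move=> p q /(congr1 val); rewrite /= !codeE => -[/val_inj/enum_rank_inj]. Qed.

Lemma code_neq0 p : code p != ord0.
Proof. by rewrite -val_eqE /= codeE. Qed.

Lemma code_neq_max p : code p != ord_max.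
Proof.
rewrite -val_eqE /= codeE eqSS neq_ltn; apply/orP; left.
by apply: leq_trans leN; apply: ltn_ord.
Qed.

Definition node x v : 'I_N.+2 := code (v, x v).

Definition node_triplet x v : triplet N.+2 :=
  if is_source v then (ord0, ord0, node x v)
  else (node x (parent1 v), node x (parent2 v), node x v).

Definition alice_set x : {set triplet N.+2} :=
  [set t | [exists v, t == node_triplet x v]
    || (t == (node x (ord0, ord0), node x (ord0, ord0), ord_max))].

Definition generated y (w : 'I_N.+2) : bool :=
  (w == ord0) || [exists v, w == code (v, Some (y v))].

Definition bob_set y : {set triplet N.+2} :=
  [set t | generated y t.1.1 && generated y t.1.2 ==> generated y t.2].

Lemma alice_set_generates x : generates (alice_set x) ord_max.
Proof.
have gen v : generates (alice_set x) (node x v).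
  (* Induction on the distance from v to the sources. *)
  have [k] := ubnP (h - (v.1 + v.2))%N; elim: k v => // k IH v lek.
  have := @generates_triplet _ (alice_set x) (node_triplet x v).1.1
            (node_triplet x v).1.2 (node_triplet x v).2.
  rewrite -!surjective_pairing => /(_ _ _ _); rewrite inE.
  have -> : [exists u, node_triplet x v == node_triplet x u] by apply/existsP; exists v.
  rewrite /node_triplet; case: ifPn => sv /= gv.
    by apply: gv => //; apply: generates_one.
  move: sv; rewrite /is_source -ltnNge => sv.
  by apply: gv => //; apply: IH; rewrite /= ?inordK; lia.
by apply: generates_triplet (gen (ord0, ord0)) (gen (ord0, ord0)); rewrite inE eqxx orbT.
Qed.

Lemma bob_set_generates y w : generates (bob_set y) w -> generated y w.
Proof.
elim=> [u|u v z].
  by case=> u0; rewrite /generated -val_eqE /= u0.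
by rewrite inE /= => /implyP H _ gu _ gv; apply: H; rewrite gu.
Qed.

Lemma generated_max y : ~~ generated y ord_max.
Proof.
rewrite negb_or -val_eqE /=; apply/existsPn => v.
by rewrite eq_sym code_neq_max.
Qed.

Lemma generated_node x y v : generated y (node x v) = (v \in agree x y).
Proof.
rewrite /generated (negbTE (code_neq0 _)) inE /=.
apply/existsP/eqP => [[u /eqP/code_inj[<- ->]]//|xv].
by exists v; rewrite /node xv.
Qed.

(* A violated internal or final triplet forces gadget_mx to vanish. *)
Definition output_mx t : {ffun V -> option W} -> {ffun V -> W} -> rat :=
  if [pick v | is_source v && [exists o, t.2 == code (v, o)]] is Some v
  then source_mx grid_free v else fun _ _ => 0.

Lemma output_mx_correct x y t :
  t \in alice_set x -> t \notin bob_set y -> output_mx t x y = gadget_mx grid_free x y.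
Proof.
rewrite !inE negb_imply => /orP[/existsP[v /eqP ->]|/eqP ->] /andP[/andP[g1 g2] g3].
  have t2 : (node_triplet x v).2 = node x v by rewrite /node_triplet; case: ifP.
  move: g3; rewrite t2 generated_node => vZ.
  (* As [code] is injective, the pick can only return v, and it does so exactly when v is a
     source. *)
  rewrite /output_mx; case: pickP => [u /andP[su /existsP[w]]|none].
    by rewrite t2 => /eqP/code_inj[<- _]; rewrite (gadget_mx_source _ vZ).
  have nsv : ~~ is_source v.
    apply: contraFN (none v) => ->; apply/existsP; exists (x v).
    by rewrite t2.
  move: g1 g2; rewrite /node_triplet (negbTE nsv) /= !generated_node => g1 g2.
  by rewrite (gadget_mx_internal _ g1 g2 vZ) // => S; apply: grid_free_internal.
move: g1; rewrite /= generated_node => g1.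
rewrite (gadget_mx_sink _ g1) => [|S]; last exact: grid_free_root.
rewrite /output_mx; case: pickP => // u /andP[_ /existsP[w /=]].
by rewrite eq_sym (negbTE (code_neq_max _)).
Qed.

Lemma rank_le_output_mx t :
  rank_le #|[set f : {ffun V -> option W} | (h <= #|undef f|)%N]| (output_mx t).
Proof.
rewrite /output_mx; case: pickP => [v /andP[sv _]|_]; last exact: rank_le0.
by apply: rank_le_source_mx => S; apply: grid_free_source.
Qed.

End Reduction.
End Grid.

(** * Embedding the game of [Gen] into a single row *)

Definition charvec (n : nat) (T : {set triplet n}) : 'rV[bool]_(n ^ 3) :=
  \row_j (enum_val (cast_ord (esym (card_triplet n)) j) \in T).

Lemma charvecK (n : nat) : cancel (@charvec n) (@set_of_charvec n).
Proof.
by move=> T; apply/setP => t; rewrite inE mxE cast_ordK enum_rankK.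
Qed.

Definition one_row_mx (m N : nat) (i0 : 'I_m) (r : 'rV[bool]_N) : 'M[bool]_(m, N) :=
  \matrix_(i, j) ((i == i0) && r 0 j).

Lemma row_one_row_mx (m N : nat) (i0 i : 'I_m) (r : 'rV[bool]_N) :
  row i (one_row_mx i0 r) = if i == i0 then r else const_mx false.
Proof.
by apply/rowP => j; rewrite !mxE; case: eqP => [_|_]; rewrite ?mxE.
Qed.

(** The rows other than [i0] are equal on both sides, so no answer is valid there; in row [i0]
    Alice's bit of [Gen] is the larger one, which forces a monotone answer. *)
Lemma solves_U_diamond_mKW_one_row (m n : nat)
    (P : protocol 'M[bool]_(m, n ^ 3) 'M[bool]_(m, n ^ 3) ('I_m * 'I_(n ^ 3)))
    (i0 : 'I_m) (T T' : {set triplet n}) :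
  solves P (U_diamond_mKW m (@Gen n)) ->
  Gen (charvec T) -> ~~ Gen (charvec T') ->
  let j := (run P (one_row_mx i0 (charvec T)) (one_row_mx i0 (charvec T'))).2 in
  let t := enum_val (cast_ord (esym (card_triplet n)) j) in
  (t \in T) && (t \notin T').
Proof.
move=> solP gT gT'.
set X := one_row_mx _ _; set Y := one_row_mx _ _.
have aE i : apply_rows (@Gen n) X i 0 = if i == i0 then true else Gen (const_mx false : 'rV_(n ^ 3)).
  by rewrite mxE row_one_row_mx; case: ifP.
have bE i : apply_rows (@Gen n) Y i 0 = if i == i0 then false else Gen (const_mx false : 'rV_(n ^ 3)).
  by rewrite mxE row_one_row_mx; case: ifP => // _; apply: negbTE.
have /solP : promise (U_diamond_mKW m (@Gen n)) X Y.
  by move=> /(congr1 (fun c : 'cV_m => c i0 0)); rewrite aE bE eqxx.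
case: (run P X Y) => i j /=; rewrite aE bE !mxE.
case: eqP => _ /=; last by case=> [[]|[]|[]] //; rewrite ltnn.
by case: (_ \in T); case: (_ \in T') => -[[]|[]|[]].
Qed.

(** * Numerical estimates and choice of parameters *)

Lemma expn_add2_le (r k : nat) :
  (4 * k <= r + 2 -> (r + 2) ^ k <= 2 * r ^ k)%N.
Proof.
move=> le4k.
(* Bernoulli's inequality for (1 - 2/(r + 2))^k, with denominators cleared. *)
have bern : ((r + 2) ^ k * (r + 2 - 2 * k) <= r ^ k * (r + 2))%N.
  elim: k le4k => [|k IH] le4k; first by rewrite !expn0; lia.
  rewrite !expnS.
  have {IH} := IH ltac:(lia).
  move: (r ^ k)%N ((r + 2) ^ k)%N => a b le_ba.
  have le_r : ((r + 2) * (r + 2 - 2 * k.+1) <= r * (r + 2 - 2 * k))%N by nia.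
  by nia.
have : ((r + 2) ^ k * (r + 2) <= 2 * r ^ k * (r + 2))%N.
  by move: (r ^ k)%N ((r + 2) ^ k)%N bern => a b bern; nia.
by rewrite leq_pmul2r // addn2.
Qed.

Lemma depth_Gen_ge (m h N r : nat)
    (P : protocol 'M[bool]_(m, N.+2 ^ 3) 'M[bool]_(m, N.+2 ^ 3) ('I_m * 'I_(N.+2 ^ 3))) :
  (0 < r)%N -> (4 * h.+1 ^ 2 <= r + 2)%N -> (h.+1 ^ 2 * r.+1 <= N)%N ->
  solves P (U_diamond_mKW m (@Gen N.+2)) -> (h <= (depth P).+1)%N.
Proof.
move=> r0 le4 leN solP.
(* Any row would do; an output of P provides one, which also covers m = 0. *)
pose i0 : 'I_m := (run P (const_mx false) (const_mx false)).1.
have cardV : #|{: 'I_h.+1 * 'I_h.+1}| = (h.+1 ^ 2)%N by rewrite card_prod card_ord.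
have leN' : (#|{: 'I_h.+1 * 'I_h.+1 * option 'I_r}| <= N)%N.
  by rewrite card_prod cardV card_option card_ord.
pose X (x : {ffun 'I_h.+1 * 'I_h.+1 -> option 'I_r}) := one_row_mx i0 (charvec (alice_set N x)).
pose Y (y : {ffun 'I_h.+1 * 'I_h.+1 -> 'I_r}) := one_row_mx i0 (charvec (bob_set N y)).
pose M (o : 'I_m * 'I_(N.+2 ^ 3)) :=
  @output_mx h 'I_r N (enum_val (cast_ord (esym (card_triplet N.+2)) o.2)).
have rkM o : rank_le _ (M o) := @rank_le_output_mx h _ N _.
have := rank_le_run P X Y rkM.
move=> /(@eq_rank_le _ _ _ _ (gadget_mx (@grid_free h))).
have eqM x y : M (run P (X x) (Y y)) x y = gadget_mx (@grid_free h) x y.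
  have gX : Gen (charvec (alice_set N x)).
    apply/asboolP; exists ord_max; split=> //; rewrite charvecK.
    exact: alice_set_generates.
  have gY : ~~ Gen (charvec (bob_set N y)).
    apply/asboolP => -[w []] /= [wN]; rewrite charvecK => /bob_set_generates.
    have -> : w = ord_max by apply: val_inj.
    by rewrite (negbTE (generated_max leN' y)).
  have /andP[tX tY] := solves_U_diamond_mKW_one_row i0 solP gX gY.
  exact: (output_mx_correct leN' tX tY).
move=> /(_ eqM) /(gadget_mx_rank (grid_free0 h)); rewrite card_ord cardV => le1.
have := @card_undef ('I_h.+1 * 'I_h.+1)%type 'I_r h.
rewrite card_ord cardV => le2; have le3 := expn_add2_le le4.
have rV : (0 < r ^ h.+1 ^ 2)%N by rewrite expn_gt0 r0.
(* With K the number of maps counted by [card_undef] and q the size of the grid: 2^h * r^q <= 2^h *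
   2^depth * K <= 2^depth * (r + 2)^q <= 2^(depth + 1) * r^q. *)
rewrite -(leq_exp2l (m := 2)) // expnS.
rewrite -(leq_pmul2l rV).
move: le1 le2 le3.
move: #|_| (r ^ _)%N ((r + 2) ^ _)%N (2 ^ depth P)%N (2 ^ h)%N => B a b D H le1 le2 le3.
nia.
Qed.

Unset Implicit Arguments.
Set Strict Implicit.

Theorem theorem6p14 (R : realType) :
  exists kappa : R, 0 < kappa /\
    forall m : nat, exists n0 : nat, forall n : nat, (n0 <= n)%N ->
      ((m%:R + kappa * (n%:R `^ (1 / 6)))%:E <=
        CC R (U_diamond_mKW m (@Gen n)))%E.
Proof.
exists 1; split=> // m; exists ((m + 12) ^ 6)%N => n len.
have ex0 : exists s, (s ^ 6 <= n)%N by exists (m + 12)%N.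
have bound s : (s ^ 6 <= n)%N -> (s <= n)%N.
  by apply: leq_trans; case: s => // s; rewrite -[X in (X <= _)%N]expn1 leq_pexp2l.
case: (ex_maxnP ex0 bound) => s les maxs.
have ms : (m + 12 <= s)%N by apply: maxs.
have ltn : (n < s.+1 ^ 6)%N.
  by rewrite ltnNge; apply/negP => /maxs; rewrite ltnn.
have root_le : n%:R `^ (1 / 6) <= s.+1%:R :> R.
  have -> : s.+1%:R = (s.+1%:R ^+ 6) `^ (1 / 6) :> R.
    by rewrite -powR_mulrn // -powRrM mulrA mulr1 divff // powRr1.
  by apply: ge0_ler_powR; rewrite ?nnegrE ?divr_ge0 ?exprn_ge0 // -natrX ler_nat ltnW.
apply: le_ereal_inf_tmp => _ [P solP <-]; rewrite lee_fin mul1r.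
apply: le_trans (lerD (lexx _) root_le) _; rewrite -natrD ler_nat.
(* Here s is the integer part of the sixth root of n, and h - 1 = m + (s + 1) is at least the
   required bound. *)
pose h := (m + s + 2)%N.
have n_gt1 : (1 < n)%N.
  by apply: leq_trans len; rewrite -[X in (X < _)%N](exp1n 6) ltn_exp2r // addnC.
case: n n_gt1 les P solP {len ltn maxs bound ex0 root_le} => [|[|N]] // _ les P solP.
suff: (h <= (depth P).+1)%N by rewrite /h; lia.
(* The threshold gives h + 1 <= 2 s, and 8 * 2^4 <= 12^2 <= s^2. The points to encode number about 4
   (h + 1)^4, so they fit in [n]. *)
have leh : (8 * h.+1 ^ 4 <= s ^ 6)%N.
  apply: (@leq_trans (8 * (2 * s) ^ 4)).
    by rewrite leq_mul2l leq_exp2r //= /h; lia.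
  rewrite expnMn mulnA (expnD s 4 2) mulnC leq_mul2l; apply/orP; right.
  apply: (@leq_trans (12 ^ 2)) => //; rewrite leq_exp2r //; lia.
apply: (@depth_Gen_ge m h N (4 * h.+1 ^ 2)) solP.
- by rewrite muln_gt0 expn_gt0.
- by rewrite leq_addr.
rewrite -2!ltnS; apply: leq_trans les; apply: leq_trans leh.
rewrite (expnM _ 2 2).
have : (0 < h.+1 ^ 2)%N by rewrite expn_gt0.
by move: (h.+1 ^ 2)%N => z; nia.
Qed.
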